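(* Let $X$ be a locale, $\mathcal{L}$ a first-order language, and $(\mathcal{M},\delta)$ an $\mathcal{O}(X)$-valued $\mathcal{L}$-structure satisfying the Assumption (stated in the context). Then the following are equivalent: (i) For every $\mathcal{L}$-formula $\varphi(v,\vec{u})$ and every tuple $\vec{a}\in\mathcal{M}^n$ there are finitely many $b_1,\dots,b_r\in\mathcal{M}$ such that \[\bigvee_i \|\varphi^G(b_i,\vec{a})\| \le \|\exists v\,\varphi^G(v,\vec{a})\| \le \neg\neg\bigvee_i \|\varphi^G(b_i,\vec{a})\| \quad\text{in } \mathcal{O}(X).\] (ii) Every maximal filter on $\mathcal{O}(X)$ is $\mathcal{M}$-generic. (iii) For every maximal filter $\mathfrak{m}$ on $\mathcal{O}(X)$, every $\mathcal{L}$-formula $\varphi(\vec{u})$ and every $\vec{a}\in\mathcal{M}^n$ with $\delta(\vec{a})\in\mathfrak{m}$, \[\Gamma(\mathcal{M}/\mathfrak{m})\models\varphi([\vec{a}]_{\mathfrak{m}}) \iff \|\varphi^G(\vec{a})\|\in\mathfrak{m}.\]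
   Context: A locale $X$ is given by its frame $\mathcal{O}(X)$ (a complete lattice with $U\wedge\bigvee_i V_i=\bigvee_i(U\wedge V_i)$, i.e. a complete Heyting algebra), with least/greatest elements $0_X,1_X$, Heyting implication $U\to V$, $\neg U:=U\to 0_X$, $U\leftrightarrow V:=(U\to V)\wedge(V\to U)$. An $\mathcal{O}(X)$-valued set $(A,\alpha)$ is a set $A$ with $\alpha:A\times A\to\mathcal{O}(X)$ symmetric and satisfying $\alpha(a,b)\wedge\alpha(b,c)\le\alpha(a,c)$; write $\alpha(a):=\alpha(a,a)$. A morphism $\varphi:(A,\alpha)\to(B,\beta)$ is a map $A\times B\to\mathcal{O}(X)$ with $\alpha(a,a')\wedge\varphi(a,b)\wedge\beta(b,b')\le\varphi(a',b')$, $\varphi(a,b)\wedge\varphi(a,b')\le\beta(b,b')$, and $\alpha(a)=\bigvee_{b}\varphi(a,b)$; composition is $(\psi\circ\varphi)(a,c)=\bigvee_b\varphi(a,b)\wedge\psi(b,c)$, identities are $\alpha$. This category $\mathbf{Set}(\mathcal{O}(X))$ is a topos. A morphism $\varphi$ is represented by a map $h:A\to B$ if $\varphi(a,b)=\alpha(a)\wedge\beta(ha,b)$. For $\vec a,\vec a'\in\mathcal{M}^n$ put $\delta(\vec a,\vec a')=\bigwedge_i\delta(a_i,a'_i)$, $\delta(\vec a)=\bigwedge_i\delta(a_i)$; $(\mathcal{M}^n,\delta)$ is the $n$-fold product. A strict relation on $(A,\alpha)$ is $\sigma:A\to\mathcal{O}(X)$ with $\sigma(a)\wedge\alpha(a,a')\le\sigma(a')$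 and $\sigma(a)\le\alpha(a)$; strict relations, ordered pointwise, correspond order-isomorphically to subobjects of $(A,\alpha)$, $\sigma$ corresponding to the mono $(A,\alpha_\sigma)\to(A,\alpha)$ represented by the identity map, where $\alpha_\sigma(a,a')=\sigma(a)\wedge\alpha(a,a')$. An $\mathcal{O}(X)$-valued $\mathcal{L}$-structure is an $\mathcal{L}$-structure in this topos: an $\mathcal{O}(X)$-valued set $(\mathcal{M},\delta)$, morphisms $f^{\mathcal{M}}:(\mathcal{M}^n,\delta)\to(\mathcal{M},\delta)$ for $n$-ary function symbols, and strict relations $R^{\mathcal{M}}$ on $(\mathcal{M}^n,\delta)$ for $n$-ary relation symbols (equality interpreted by the diagonal, i.e. the strict relation $(a,b)\mapsto\delta(a,b)$). For an $\mathcal{L}$-formula $\varphi(\vec u)$ in context $\vec u=u_1,\dots,u_n$, let $[\![\vec u.\varphi]\!]$ be its standard categorical (topos) interpretation as a subobject of $(\mathcal{M},\delta)^n$, and for $\vec a\in\mathcal{M}^n$ the forcing value $\|\varphi(\vec a)\|\in\mathcal{O}(X)$ is the value at $\vec a$ of the corresponding strict relation. (For $\varphi(v,\vec u)$ the context is $v,\vec u$.) Assumption: for each function symbol $f$, $f^{\mathcal{M}}$ is represented by some map $h:\mathcal{M}^n\to\mathcal{M}$ with $\delta(\vec a,\vec a')\le\delta(h\vec a,h\vec a')$ and $\delta(h\vec a)=\delta(\vec a)$ for all $\vec a,\vec a'$. Filter-quotient: for a filter $\mathfrak{f}$ on $\mathcal{O}(X)$, define $a\sim_{\mathfrak f}b$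 iff $(\delta(a)\vee\delta(b)\to\delta(a,b))\in\mathfrak f$, an equivalence relation on $\mathcal{M}$; $[a]_{\mathfrak f}$ denotes the class. $\Gamma(\mathcal{M}/\mathfrak f)$ is the ordinary $\mathcal{L}$-structure whose universe is $\{[a]_{\mathfrak f}: \delta(a)\in\mathfrak f\}$, with $f([\vec a]_{\mathfrak f})=[h(\vec a)]_{\mathfrak f}$ ($h$ as in the Assumption) and $R([\vec a]_{\mathfrak f})$ true iff $R^{\mathcal{M}}(\vec a)\in\mathfrak f$; $[\vec a]_{\mathfrak f}$ denotes the tuple of classes. Gödel translation $\varphi^G$: $\bot^G=\bot$; $\varphi^G=\neg\neg\varphi$ for atomic $\varphi\ne\bot$; $(\varphi\wedge\psi)^G=\varphi^G\wedge\psi^G$; $(\varphi\vee\psi)^G=\neg(\neg\varphi^G\wedge\neg\psi^G)$; $(\varphi\rightarrow\psi)^G=\varphi^G\rightarrow\psi^G$; $(\forall v\varphi)^G=\forall v\varphi^G$; $(\exists v\varphi)^G=\neg\forall v\neg\varphi^G$. A filter $\mathfrak f$ on $\mathcal{O}(X)$ is $\mathcal{M}$-generic if: (1) for every $\mathcal{L}$-formula $\varphi(\vec u)$ and $\vec a$ with $\delta(\vec a)\in\mathfrak f$, either $\|\varphi^G(\vec a)\|\in\mathfrak f$ or $\|\neg\varphi^G(\vec a)\|\in\mathfrak f$; (2) for every $\varphi(v,\vec u)$ and $\vec a$ with $\delta(\vec a)\in\mathfrak f$, if $\|\exists v\varphi^G(v,\vec a)\|\in\mathfrak f$ then $\|\varphi^G(b,\vec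 a)\|\in\mathfrak f$ for some $b\in\mathcal{M}$. A maximal filter means a maximal proper filter. *)

(* Defs.v *)
From HB Require Import structures.
From mathcomp Require Import all_boot all_order.
From mathcomp Require Import boolp classical_sets.

Set Implicit Arguments.
Unset Strict Implicit.
Unset Printing Implicit Defensive.

Import Order.TTheory.
Local Open Scope classical_set_scope.
Local Open Scope order_scope.

(* Frames.  Finite distributivity, and the choice structure underlying the
   order hierarchy, are no restriction: the former follows from
   [meet_bigvee], the latter exists classically on every type. *)
HB.mixin Record isFrame (d : Order.disp_t) T of Order.TBDistrLattice d T := {
  bigvee : set T -> T;
  bigvee_ub : forall (A : set T) x, A x -> x <= bigvee A;
  bigvee_le : forall (A : set T) y, (forall x, A x -> x <= y) -> bigvee A <= y;
  meet_bigvee : forall x (A : set T),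
    x `&` bigvee A = bigvee [set x `&` y | y in A] }.

#[short(type="frameType")]
HB.structure Definition Frame (d : Order.disp_t) :=
  {T of Order.TBDistrLattice d T & isFrame d T}.

Section FrameOps.
Context {d : Order.disp_t} {O : frameType d}.
Implicit Types x y z : O.

Definition vee {I : Type} (F : I -> O) : O := bigvee (range F).
Definition himp x y : O := bigvee [set z | z `&` x <= y].
Definition hneg x : O := himp x \bot.

Lemma vee_ub I (F : I -> O) i : F i <= vee F.
Proof. by apply: bigvee_ub; exists i. Qed.

Lemma vee_le I (F : I -> O) y : (forall i, F i <= y) -> vee F <= y.
Proof. by move=> Fy; apply: bigvee_le => _ [i _ <-]. Qed.

Lemma vee_ge I (F : I -> O) y i : y <= F i -> y <= vee F.
Proof. by move/le_trans; apply; exact: vee_ub. Qed.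

Lemma meet_vee I x (F : I -> O) : x `&` vee F = vee (fun i => x `&` F i).
Proof.
rewrite meet_bigvee; apply/le_anti/andP; split.
  by apply: bigvee_le => _ [_ [i _ <-] <-]; exact: (vee_ub (fun i => x `&` F i)).
by apply: vee_le => i; apply: bigvee_ub; exists (F i) => //; exists i.
Qed.

Lemma meet_vee_le I x (F : I -> O) y :
  (forall i, x `&` F i <= y) -> x `&` vee F <= y.
Proof. by rewrite meet_vee; exact: vee_le. Qed.

Lemma vee_meet_le I x (F : I -> O) y :
  (forall i, F i `&` x <= y) -> vee F `&` x <= y.
Proof. by move=> H; rewrite meetC; apply: meet_vee_le => i; rewrite meetC. Qed.

Lemma le_himp x y z : (z <= himp x y) = (z `&` x <= y).
Proof.
apply/idP/idP => [zxy|]; last by move=> ?; exact: bigvee_ub.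
apply: le_trans (leI2 zxy (lexx x)) _; rewrite meetC meet_bigvee.
by apply: bigvee_le => _ [t /= txy <-]; rewrite meetC.
Qed.

Lemma bigmeet_le k (F : 'I_k -> O) i : \meet_(j < k) F j <= F i.
Proof. by rewrite (bigD1 i) //= leIl. Qed.

Lemma le_bigmeet k (F : 'I_k -> O) x :
  (forall i, x <= F i) -> x <= \meet_(j < k) F j.
Proof. by move=> xF; elim/big_rec: _ => [|i y _ ?]; rewrite ?lex1 ?lexI ?xF. Qed.

Lemma bigmeet_vee_le k B (F : 'I_k -> B -> O) :
  \meet_(i < k) vee (F i) <=
  vee (fun b : 'I_k -> B => \meet_(i < k) F i (b i)).
Proof.
suff H m (g : 'I_m -> 'I_k) : \meet_(i < m) vee (F (g i)) <=
    vee (fun b : 'I_m -> B => \meet_(i < m) F (g i) (b i)).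
  exact: (H k id).
elim: m g => [|m IH] g.
  have b : 'I_0 -> B by case.
  by apply: (vee_ge (i := b)); rewrite !big_ord0.
rewrite big_ord_recl.
apply: le_trans (leI2 (lexx _) (IH (fun i => g (lift ord0 i)))) _.
apply: meet_vee_le => b; apply: vee_meet_le => c.
apply: (vee_ge (i := fun i => oapp b c (unlift ord0 i))).
rewrite big_ord_recl unlift_none /= leI2 //.
by apply: le_bigmeet => i; rewrite liftK; exact: (bigmeet_le (fun i => _)).
Qed.

End FrameOps.

(* Solves goals whose right-hand side is a meet of meet-factors of the left. *)
Ltac le_proj :=
  solve [assumption | exact: lexx | apply: leIxl; le_proj | apply: leIxr; le_proj].
Ltac le_meets := rewrite ?lexI; repeat (apply/andP; split); le_proj.

Record vset (d : Order.disp_t) (O : frameType d) : Type := VSet {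
  vcarrier :> Type;
  veq : vcarrier -> vcarrier -> O;
  veq_sym : forall a b, veq a b = veq b a;
  veq_trans : forall a b c, veq a b `&` veq b c <= veq a c }.

Definition vext (d : Order.disp_t) (O : frameType d) (A : vset O) (a : A) : O :=
  veq a a.

Record mor (d : Order.disp_t) (O : frameType d) (A B : vset O) : Type := Mor {
  mor_val :> A -> B -> O;
  mor_veq : forall a a' b b',
    veq a a' `&` mor_val a b `&` veq b b' <= mor_val a' b';
  mor_sv : forall a b b', mor_val a b `&` mor_val a b' <= veq b b';
  mor_total : forall a, vext a = vee (mor_val a) }.

Section Category.
Context {d : Order.disp_t} {O : frameType d}.
Implicit Types (A B C : vset O) (x : O).

Lemma veqT A (a b c : A) x : x <= veq a b -> x <= veq b c -> x <= veq a c.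
Proof. by move=> ? ?; apply: le_trans (veq_trans a b c); rewrite lexI; apply/andP. Qed.

Lemma veqS A (a b : A) x : x <= veq a b -> x <= veq b a.
Proof. by rewrite veq_sym. Qed.

Lemma veq_l A (a b : A) x : x <= veq a b -> x <= veq a a.
Proof. by move=> ab; apply: veqT (ab) (veqS ab). Qed.

Lemma veq_r A (a b : A) x : x <= veq a b -> x <= veq b b.
Proof. by move=> ab; apply: veqT (veqS ab) (ab). Qed.

Lemma morE A B (f : mor A B) a a' b b' x :
  x <= veq a a' -> x <= f a b -> x <= veq b b' -> x <= f a' b'.
Proof.
by move=> ? ? ?; apply: le_trans (mor_veq f a a' b b'); rewrite !lexI; apply/andP; split=> //; apply/andP.
Qed.

Lemma morV A B (f : mor A B) a b b' x : x <= f a b -> x <= f a b' -> x <= veq b b'.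
Proof. by move=> ? ?; apply: le_trans (mor_sv f a b b'); rewrite lexI; apply/andP. Qed.

Lemma mor_dom A B (f : mor A B) a b x : x <= f a b -> x <= veq a a.
Proof. by move=> fx; rewrite -[veq a a]/(vext a) (mor_total f); exact: vee_ge fx. Qed.

Lemma mor_cod A B (f : mor A B) a b x : x <= f a b -> x <= veq b b.
Proof. by move=> fx; apply: morV (fx) (fx). Qed.

Definition represents A B (h : A -> B) (f : mor A B) : Prop :=
  forall a b, f a b = vext a `&` veq (h a) b.

Section Represented.
Variables (A B : vset O) (h : A -> B).
Hypothesis h_le : forall a a', veq a a' <= veq (h a) (h a').

Let hv a b := vext a `&` veq (h a) b.

Let hv_veq a a' b b' : veq a a' `&` hv a b `&` veq b b' <= hv a' b'.
Proof.
rewrite /hv; set x := (X in X <= _).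
have aa' : x <= veq a a' by le_meets.
have hb : x <= veq (h a) b by le_meets.
have bb' : x <= veq b b' by le_meets.
rewrite lexI (veq_r aa') /=.
by apply: veqT bb'; apply: veqT hb; apply: veqS; exact: le_trans aa' (h_le _ _).
Qed.

Let hv_sv a b b' : hv a b `&` hv a b' <= veq b b'.
Proof. by apply: (@veqT B b (h a)); [apply: veqS|]; le_meets. Qed.

Let hv_total a : vext a = vee (hv a).
Proof.
apply/le_anti/andP; split; last by apply: vee_le => b; exact: leIl.
by apply: (vee_ge (i := h a)); rewrite lexI lexx h_le.
Qed.

Definition rep_mor : mor A B := Mor hv_veq hv_sv hv_total.

Lemma rep_morP : represents h rep_mor. Proof. by []. Qed.

End Represented.

Section Comp.
Variables (A B C : vset O) (g : mor B C) (f : mor A B).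

Let cv a c := vee (fun b => f a b `&` g b c).

Let cv_veq a a' c c' : veq a a' `&` cv a c `&` veq c c' <= cv a' c'.
Proof.
rewrite -meetA meetCA; apply: vee_meet_le => b; set x := (X in X <= _).
have aa' : x <= veq a a' by le_meets.
have cc' : x <= veq c c' by le_meets.
have ab : x <= f a b by le_meets.
have bc : x <= g b c by le_meets.
apply: (vee_ge (i := b)); rewrite lexI; apply/andP; split.
  exact: (morE aa' ab (mor_cod ab)).
exact: (morE (mor_cod ab) bc cc').
Qed.

Let cv_sv a c c' : cv a c `&` cv a c' <= veq c c'.
Proof.
apply: vee_meet_le => b; apply: meet_vee_le => b'; set x := (X in X <= _).
have ab : x <= f a b by le_meets.
have bc : x <= g b c by le_meets.
have ab' : x <= f a b' by le_meets.
have bc' : x <= g b' c' by le_meets.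
exact: (morV (morE (morV ab ab') bc (mor_cod bc)) bc').
Qed.

Let cv_total a : vext a = vee (cv a).
Proof.
apply/le_anti/andP; split.
  rewrite (mor_total f); apply: vee_le => b.
  have /meet_idPl <- : f a b <= vext b by exact: mor_cod (lexx _).
  rewrite (mor_total g); apply: meet_vee_le => c.
  by apply: (vee_ge (i := c)); apply: (vee_ge (i := b)).
by apply: vee_le => c; apply: vee_le => b; apply: (@mor_dom _ _ f _ b); le_meets.
Qed.

Definition comp : mor A C := Mor cv_veq cv_sv cv_total.

End Comp.

Definition idm A : mor A A := @rep_mor A A id (fun _ _ => lexx _).

Lemma idmE A (a b : A) : idm A a b = veq a b.
Proof. by apply/meet_idPr; exact: veq_l (lexx _). Qed.

Lemma comp_idl A B (f : mor A B) : comp (idm B) f =2 f.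
Proof.
move=> a b; apply/le_anti/andP; split.
  apply: vee_le => b'; rewrite idmE; apply: (@morE _ _ f a a b'); try le_meets.
  by apply: (@mor_dom _ _ f _ b'); le_meets.
apply: (vee_ge (i := b)); rewrite idmE lexI lexx /=; exact: mor_cod (lexx _).
Qed.

Lemma comp_idr A B (f : mor A B) : comp f (idm A) =2 f.
Proof.
move=> a b; apply/le_anti/andP; split.
  apply: vee_le => a'; rewrite idmE; apply: (@morE _ _ f a' a b); try le_meets.
    by apply: veqS; le_meets.
  by apply: (@mor_cod _ _ f a'); le_meets.
apply: (vee_ge (i := a)); rewrite idmE lexI lexx andbT; exact: mor_dom (lexx _).
Qed.

Lemma eq_comp A B C (g g' : mor B C) (f f' : mor A B) :
  g =2 g' -> f =2 f' -> comp g f =2 comp g' f'.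
Proof.
by move=> gg ff a c; apply/le_anti/andP; split; apply: vee_le => b;
   apply: (vee_ge (i := b)); rewrite gg ff.
Qed.

Lemma compA A B C D (h : mor C D) (g : mor B C) (f : mor A B) :
  comp h (comp g f) =2 comp (comp h g) f.
Proof.
move=> a e; apply/le_anti/andP; split.
  apply: vee_le => c; apply: vee_meet_le => b.
  apply: (vee_ge (i := b)); rewrite -meetA leI2 //.
  by apply: (vee_ge (i := c)).
apply: vee_le => b; apply: meet_vee_le => c.
by apply: (vee_ge (i := c)); rewrite meetA leI2 //; apply: (vee_ge (i := b)).
Qed.

Definition mono A B (f : mor A B) : Prop :=
  forall C (g h : mor C A), comp f g =2 comp f h -> g =2 h.

Section Power.
Variables (A : vset O) (n : nat).

Let pv (a b : 'I_n -> A) : O := \meet_(i < n) veq (a i) (b i).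

Let pv_sym a b : pv a b = pv b a.
Proof. by apply: eq_bigr => i _; exact: veq_sym. Qed.

Let pv_trans a b c : pv a b `&` pv b c <= pv a c.
Proof.
apply: le_bigmeet => i; apply: (@veqT _ _ (b i)).
  by apply: leIxl; exact: (bigmeet_le (fun i => veq (a i) (b i))).
by apply: leIxr; exact: (bigmeet_le (fun i => veq (b i) (c i))).
Qed.

Definition power : vset O := @VSet d O ('I_n -> A) pv pv_sym pv_trans.

Lemma le_power (a b : power) x :
  (forall i, x <= veq (a i) (b i)) -> x <= veq a b.
Proof. exact: le_bigmeet. Qed.

Lemma power_le (a b : power) i : veq a b <= veq (a i) (b i).
Proof. exact: (bigmeet_le (fun i => veq (a i) (b i))). Qed.

Definition proj (i : 'I_n) : mor power A :=
  @rep_mor power A (fun a => a i) (fun a b => power_le a b i).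

Section Tupling.
Variables (B : vset O) (f : 'I_n -> mor B A).

(* The factor [vext b] matters only when [n = 0]. *)
Let tv (b : B) (a : power) : O := vext b `&` \meet_(i < n) f i b (a i).

Let tvE b a i : tv b a <= f i b (a i).
Proof. by apply: leIxr; exact: (bigmeet_le (fun i => f i b (a i))). Qed.

Let tv_veq b b' a a' : veq b b' `&` tv b a `&` veq a a' <= tv b' a'.
Proof.
set x := (X in X <= _); have bb' : x <= veq b b' by le_meets.
have ba : x <= tv b a by le_meets.
have aa' : x <= veq a a' by le_meets.
rewrite lexI (veq_r bb') /=; apply: le_bigmeet => i.
by apply: morE bb' (le_trans ba (tvE b a i)) (le_trans aa' (power_le a a' i)).
Qed.

Let tv_sv b a a' : tv b a `&` tv b a' <= veq a a'.
Proof.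
by apply: le_power => i; apply: (@morV _ _ (f i) b); [apply: leIxl|apply: leIxr]; exact: tvE.
Qed.

Let tv_total b : vext b = vee (tv b).
Proof.
apply/le_anti/andP; split; last by apply: vee_le => a; exact: leIl.
rewrite -[vee (tv b)]meet_vee lexI lexx /=.
apply: le_trans (bigmeet_vee_le (fun i => f i b)).
by apply: le_bigmeet => i; rewrite -mor_total.
Qed.

Definition tupling : mor B power := Mor tv_veq tv_sv tv_total.

Lemma proj_tupling i : comp (proj i) tupling =2 f i.
Proof.
move=> b a; apply/le_anti/andP; split.
  apply: vee_le => c; set x := (X in X <= _).
  have bc : x <= tv b c by le_meets.
  have ca : x <= veq (c i) a by le_meets.
  by apply: morE (le_trans bc (tvE b c i)) ca; apply: le_trans bc (leIl _ _).
set x := f i b a; have xb : x <= vext b by exact: (mor_dom (lexx x)).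
rewrite -(meet_idPl xb) (mor_total tupling) meet_vee.
apply: vee_le => c; apply: (vee_ge (i := c)); set y := (X in X <= _).
have bc : y <= tupling b c by le_meets.
have yc : y <= veq c c by apply: (@mor_cod _ _ tupling b).
rewrite lexI bc /= lexI yc; apply: (morV (le_trans bc (tvE b c i))); le_meets.
Qed.

Lemma tupling_unique (g : mor B power) :
  (forall i, comp (proj i) g =2 f i) -> g =2 tupling.
Proof.
move=> gf; have gle b a : g b a <= tv b a.
  rewrite lexI (mor_dom (lexx (g b a))) /=; apply: le_bigmeet => i.
  have ba := mor_cod (lexx (g b a)).
  rewrite -gf; apply: (vee_ge (i := a)).
  by rewrite !lexI lexx ba (le_trans ba (power_le a a i)).
move=> b a; apply/le_anti; rewrite gle /= -[tv b a]/(tv b a).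
have /meet_idPl <- : tv b a <= vext b by exact: leIl.
rewrite (mor_total g); apply: meet_vee_le => c; set x := (X in X <= _).
have ba : x <= tv b a by le_meets.
have bc : x <= g b c by le_meets.
have ca : x <= veq c a.
  by apply: (@morV _ _ tupling b _ _ _ (le_trans bc (gle b c)) ba).
by apply: morE (mor_dom bc) bc ca.
Qed.

End Tupling.
End Power.

Definition tcons {A : Type} {n : nat} (b : A) (a : 'I_n -> A) : 'I_n.+1 -> A :=
  fun i => oapp a b (unlift ord0 i).

Definition ttail {A : Type} {n : nat} (a : 'I_n.+1 -> A) : 'I_n -> A :=
  fun i => a (lift ord0 i).

Lemma ttail_le A n (a b : power A n.+1) :
  veq a b <= @veq d O (power A n) (ttail a) (ttail b).
Proof. by apply: le_power => i; exact: power_le. Qed.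

Definition drop_proj A n : mor (power A n.+1) (power A n) :=
  @rep_mor (power A n.+1) (power A n) ttail (@ttail_le A n).

End Category.

(* Strict relations stand for subobjects: [s] for the mono [incl s].  That this
   is an order isomorphism is [incl_mono], [incl_le] and [mono_image] below. *)

Record srel (d : Order.disp_t) (O : frameType d) (A : vset O) : Type := SRel {
  srel_val :> A -> O;
  srel_veq : forall a a', srel_val a `&` veq a a' <= srel_val a';
  srel_strict : forall a, srel_val a <= vext a }.

Section StrictRelations.
Context {d : Order.disp_t} {O : frameType d}.
Implicit Types (A B C : vset O) (x : O).

Definition srel_le A (s t : srel A) : Prop := forall a, s a <= t a.

Lemma srelE A (s : srel A) a a' x : x <= s a -> x <= veq a a' -> x <= s a'.
Proof. by move=> ? ?; apply: le_trans (srel_veq s a a'); rewrite lexI; apply/andP. Qed.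

Section Restriction.
Variables (A : vset O) (s : srel A).

Let rv a a' := s a `&` veq a a'.

Let rv_sym a b : rv a b = rv b a.
Proof.
by apply/le_anti/andP; split; rewrite lexI; apply/andP; split;
   try (by apply: veqS; le_meets);
   [apply: (@srelE _ s a)|apply: (@srelE _ s b)]; le_meets.
Qed.

Let rv_trans a b c : rv a b `&` rv b c <= rv a c.
Proof.
rewrite lexI; apply/andP; split; first by le_meets.
by apply: (@veqT _ _ _ _ b); le_meets.
Qed.

Definition restr : vset O := VSet rv_sym rv_trans.

Definition incl : mor restr A :=
  @rep_mor d O restr A id (fun a a' => leIr (@veq d O A a a') (s a)).

Lemma inclE (a b : A) : incl a b = s a `&` veq a b.
Proof.
rewrite /= /vext /= /rv; apply/le_anti/andP; split; first by le_meets.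
set x := (X in X <= _); have ab : x <= veq a b by le_meets.
by rewrite !lexI (veq_l ab) ab leIl.
Qed.

End Restriction.

Lemma incl_mono A (s : srel A) : mono (incl s).
Proof.
have le_incl C (g h : mor C (restr s)) :
    comp (incl s) g =2 comp (incl s) h -> forall c a, g c a <= h c a.
  move=> gh c a; have ga := mor_cod (lexx (g c a)).
  have : g c a <= comp (incl s) h c a.
    rewrite -gh; apply: (vee_ge (i := a)); rewrite inclE lexI lexx.
    exact: ga.
  move=> H; rewrite -(meet_idPl H); apply: meet_vee_le => b; rewrite inclE.
  apply: (@morE _ _ _ _ h c c b); try le_meets.
  by apply: (@mor_dom _ _ _ _ h c b); le_meets.
by move=> C g h gh c a; apply/le_anti; rewrite !le_incl.
Qed.

Lemma incl_le A (s t : srel A) :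
  srel_le s t <->
  exists e : mor (restr s) (restr t), comp (incl t) e =2 incl s.
Proof.
split=> [st|[e es] a].
  have ee a a' : @veq d O (restr s) a a' <= @veq d O (restr t) a a'.
    by rewrite leI2.
  exists (@rep_mor _ _ (restr s) (restr t) id ee) => a b.
  apply/le_anti/andP; split.
    apply: vee_le => c; rewrite !inclE lexI; apply/andP; split.
      by rewrite /= /vext /=; le_meets.
    by apply: (@veqT _ _ A _ c); rewrite /= /vext /=; le_meets.
  apply: (vee_ge (i := a)); rewrite !inclE /= /vext /= !lexI; set x := s a `&` _.
  have xs : x <= s a by exact: leIl.
  have xab : x <= @veq d O A a b by exact: leIr.
  by rewrite xs (le_trans xs (st a)) (veq_l xab) xab.
have : s a <= incl s a a by rewrite inclE lexI lexx; exact: srel_strict.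
rewrite -es => /le_trans; apply; apply: vee_le => b; rewrite inclE.
by apply: (@srelE _ t b); le_meets.
Qed.

Section Image.
Variables (A B : vset O) (m : mor B A).

Let iv a := vee (fun b => m b a).

Let iv_veq a a' : iv a `&` veq a a' <= iv a'.
Proof.
apply: vee_meet_le => b; apply: (vee_ge (i := b)).
apply: (@morE _ _ _ _ m b b a); try le_meets.
by apply: (@mor_dom _ _ _ _ m b a); le_meets.
Qed.

Let iv_strict a : iv a <= vext a.
Proof. by apply: vee_le => b; exact: mor_cod (lexx _). Qed.

Definition image : srel A := SRel iv_veq iv_strict.

Lemma mono_inj : mono m -> forall b b' a, m b a `&` m b' a <= veq b b'.
Proof.
move=> mm b b' a; set u := (X in X <= _).
have mb : u <= m b a by le_meets.
have mb' : u <= m b' a by le_meets.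
clearbody u.
pose C := @VSet d O unit (fun _ _ => u) (fun _ _ => erefl) (fun _ _ _ => leIl u u).
have hb (b0 : B) : u <= m b0 a -> forall c c' : C, veq c c' <= veq b0 b0.
  by move=> ub ? ?; exact: mor_dom ub.
pose g := @rep_mor _ _ C B (fun=> b) (hb b mb).
pose h := @rep_mor _ _ C B (fun=> b') (hb b' mb').
have mE (b0 : B) (ub : u <= m b0 a) (c : C) a0 :
    comp m (@rep_mor _ _ C B (fun=> b0) (hb b0 ub)) c a0 = u `&` veq a a0.
  apply/le_anti/andP; split.
    apply: vee_le => b1; rewrite /= /vext /=; set x := (X in X <= _).
    have xu : x <= u by le_meets.
    rewrite lexI xu /=; apply: (@morV _ _ _ _ m b1); last by le_meets.
    apply: (@morE _ _ _ _ m b0 b1 a); first by le_meets.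
      exact: le_trans xu ub.
    by apply: le_trans xu (mor_cod ub).
  apply: (vee_ge (i := b0)); rewrite /= /vext /= !lexI leIl /=.
  rewrite (le_trans (leIl _ _) (mor_dom ub)) /=.
  apply: (@morE _ _ _ _ m b0 b0 a); last exact: leIr.
    exact: le_trans (leIl _ _) (mor_dom ub).
  exact: le_trans (leIl _ _) ub.
have gh : g =2 h by apply: mm => c a0; rewrite !mE.
have : u <= g tt b by rewrite /= /vext /= lexI lexx (mor_dom mb).
by rewrite gh => /le_trans; apply; apply: veqS; exact: leIr.
Qed.

Lemma mono_image : mono m ->
  exists (e : mor B (restr image)) (e' : mor (restr image) B),
    [/\ comp e' e =2 idm B, comp e e' =2 idm (restr image)
      & comp (incl image) e =2 m].
Proof.
move=> mm.
have le_im b a x : x <= m b a -> x <= image a by move=> ?; exact: (vee_ge (i := b)).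
have e1 b b' a a' :
    veq b b' `&` m b a `&` @veq d O (restr image) a a' <= m b' a'.
  by apply: (@morE _ _ _ _ m b b' a); try le_meets; rewrite /=; le_meets.
have e2 b a a' : m b a `&` m b a' <= @veq d O (restr image) a a'.
  by rewrite /= lexI (le_im b) ?leIl // mor_sv.
have e3 b : vext b = vee (m b) by exact: mor_total.
pose e := @Mor d O B (restr image) m e1 e2 e3.
have f1 a a' b b' :
    @veq d O (restr image) a a' `&` m b a `&` veq b b' <= m b' a'.
  by apply: (@morE _ _ _ _ m b b' a); rewrite /=; le_meets.
have f2 a b b' : m b a `&` m b' a <= veq b b' by exact: mono_inj.
have f3 a : @vext d O (restr image) a = vee (fun b => m b a).
  by apply/meet_idPl; exact: srel_strict.
pose e' := @Mor d O (restr image) B (fun a b => m b a) f1 f2 f3.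
exists e, e'; split=> [b b'|a a'|b a].
- rewrite idmE; apply/le_anti/andP; split; first by apply: vee_le => a; exact: f2.
  have /meet_idPl <- : veq b b' <= vext b by exact: veq_l (lexx _).
  rewrite (mor_total m); apply: meet_vee_le => a; apply: (vee_ge (i := a)).
  rewrite lexI leIr /=; apply: (@morE _ _ _ _ m b b' a); try le_meets.
  by apply: (@mor_cod _ _ _ _ m b); le_meets.
- rewrite idmE; apply/le_anti/andP; split; first by apply: vee_le => b; exact: e2.
  rewrite /=; apply: vee_meet_le => b; apply: (vee_ge (i := b)).
  rewrite /= lexI leIl /=; apply: (@morE _ _ _ _ m b b a); try le_meets.
  by apply: (@mor_dom _ _ _ _ m b a); le_meets.
- apply/le_anti/andP; split.
    apply: vee_le => a'; rewrite inclE; apply: (@morE _ _ _ _ m b b a'); try le_meets.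
      by apply: (@mor_dom _ _ _ _ m b a'); le_meets.
  apply: (vee_ge (i := a)); rewrite inclE !lexI lexx (le_im b) //=.
  exact: mor_cod (lexx _).
Qed.

End Image.

Section Pullback.
Variables (A B : vset O) (f : mor A B) (t : srel B).

Let pv a := vee (fun b => f a b `&` t b).

Let pv_veq a a' : pv a `&` veq a a' <= pv a'.
Proof.
apply: vee_meet_le => b; apply: (vee_ge (i := b)); rewrite lexI; apply/andP; split.
  apply: (@morE _ _ _ _ f a a' b); try le_meets.
  by apply: (@mor_cod _ _ _ _ f a); le_meets.
by le_meets.
Qed.

Let pv_strict a : pv a <= vext a.
Proof. by apply: vee_le => b; apply: (@mor_dom _ _ _ _ f a b); exact: leIl. Qed.

Definition pullback : srel A := SRel pv_veq pv_strict.

Lemma pullbackP :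
  exists2 q : mor (restr pullback) (restr t),
    comp (incl t) q =2 comp f (incl pullback) &
  forall C (g : mor C A) (k : mor C (restr t)),
    comp (incl t) k =2 comp f g ->
  exists2 u : mor C (restr pullback),
    comp (incl pullback) u =2 g /\ comp q u =2 k &
  forall u' : mor C (restr pullback),
    comp (incl pullback) u' =2 g -> comp q u' =2 k -> u' =2 u.
Proof.
have q1 a a' b b' : @veq d O (restr pullback) a a' `&` (f a b `&` t b) `&`
    @veq d O (restr t) b b' <= f a' b' `&` t b'.
  rewrite lexI /=; apply/andP; split.
    by apply: (@morE _ _ _ _ f a a' b); le_meets.
  by apply: (@srelE _ t b); le_meets.
have q2 a b b' : (f a b `&` t b) `&` (f a b' `&` t b') <= @veq d O (restr t) b b'.
  rewrite lexI /=; apply/andP; split; first by le_meets.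
  by apply: (@morV _ _ _ _ f a); le_meets.
have q3 a : @vext d O (restr pullback) a = vee (fun b => f a b `&` t b).
  by apply/meet_idPl; exact: pv_strict.
pose q := @Mor d O (restr pullback) (restr t) _ q1 q2 q3.
have qE : comp (incl t) q =2 comp f (incl pullback).
  move=> a b; apply/le_anti/andP; split.
    apply: vee_le => b'; rewrite inclE; set x := (X in X <= _).
    have ab' : x <= f a b' by rewrite /x /=; le_meets.
    have tb' : x <= t b' by rewrite /x /=; le_meets.
    have bb' : x <= @veq d O B b' b by rewrite /x /=; le_meets.
    apply: (vee_ge (i := a)); rewrite inclE !lexI (mor_dom ab').
    rewrite (morE (mor_dom ab') ab' bb') /= !andbT.
    by apply: (vee_ge (i := b')); rewrite lexI ab' tb'.
  apply: vee_le => a'; rewrite inclE; set x := (X in X <= _).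
  have aa' : x <= @veq d O A a a' by rewrite /x; le_meets.
  have a'b : x <= f a' b by rewrite /x; le_meets.
  have ab : x <= f a b by apply: morE (veqS aa') a'b (mor_cod a'b).
  have xp : x <= pullback a by rewrite /x; le_meets.
  rewrite -(meet_idPl xp); apply: meet_vee_le => b'; apply: (vee_ge (i := b')).
  rewrite inclE !lexI /=; set y := (X in X <= _).
  have yx : y <= x by exact: leIl.
  have fb' : y <= f a b' by rewrite /y; le_meets.
  have tb' : y <= t b' by rewrite /y; le_meets.
  by rewrite fb' tb' /=; apply: morV fb' (le_trans yx ab).
exists q => // C g k kg.
have gp c a : g c a <= pullback a.
  have /meet_idPl <- : g c a <= vext a by exact: mor_cod (lexx _).
  rewrite (mor_total f); apply: meet_vee_le => b; set x := (X in X <= _).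
  have ca : x <= g c a by le_meets.
  have ab : x <= f a b by le_meets.
  have : x <= comp (incl t) k c b.
    by rewrite kg; apply: (vee_ge (i := a)); rewrite lexI ca.
  move=> H; rewrite -(meet_idPl H); apply: meet_vee_le => b'.
  apply: (vee_ge (i := b)); rewrite inclE lexI; apply/andP; split.
    by apply: le_trans ab; exact: leIl.
  by apply: (@srelE _ t b'); le_meets.
have u1 c c' a a' :
    veq c c' `&` g c a `&` @veq d O (restr pullback) a a' <= g c' a'.
  by apply: (@morE _ _ _ _ g c c' a); rewrite /=; le_meets.
have u2 c a a' : g c a `&` g c a' <= @veq d O (restr pullback) a a'.
  rewrite lexI mor_sv andbT; apply: le_trans (gp c a); exact: leIl.
have u3 c : vext c = vee (g c) by exact: mor_total.
pose u := @Mor d O C (restr pullback) g u1 u2 u3.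
have ug : comp (incl pullback) u =2 g.
  move=> c a; apply/le_anti/andP; split.
    apply: vee_le => a'; rewrite inclE; apply: (@morE _ _ _ _ g c c a'); try le_meets.
      by apply: (@mor_dom _ _ _ _ g c a'); le_meets.
  apply: (vee_ge (i := a)); rewrite inclE !lexI lexx gp /=.
  exact: mor_cod (lexx _).
exists u; last by move=> u' u'g _; apply: (@incl_mono _ pullback) => c a; rewrite u'g ug.
split=> //; apply: (@incl_mono _ t) => c b.
rewrite compA (eq_comp qE (fun _ _ => erefl)) -compA kg.
by apply: eq_comp.
Qed.

End Pullback.

Section Lattice.
Variable A : vset O.
Implicit Types (s t r : srel A) (S : set (srel A)).

Section Sup.
Variable S : set (srel A).

Let sv a := bigvee [set s a | s in S].

Let sv_veq a a' : sv a `&` veq a a' <= sv a'.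
Proof.
rewrite meetC meet_bigvee; apply: bigvee_le => _ [_ [s Ss <-] <-].
apply: (@le_trans _ _ (s a')); first by rewrite meetC; exact: srel_veq.
by apply: bigvee_ub; exists s.
Qed.

Let sv_strict a : sv a <= vext a.
Proof. by apply: bigvee_le => _ [s Ss <-]; exact: srel_strict. Qed.

Definition srel_sup : srel A := SRel sv_veq sv_strict.

End Sup.

Definition srel_inf S : srel A :=
  srel_sup [set r | forall s, S s -> srel_le r s].

Definition srel_bot : srel A := srel_sup set0.
Definition srel_join s t : srel A := srel_sup [set s; t].
Definition srel_meet s t : srel A := srel_inf [set s; t].
Definition srel_imp s t : srel A :=
  srel_sup [set r | srel_le (srel_meet r s) t].

Lemma srel_supP S r : srel_le (srel_sup S) r <-> (forall s, S s -> srel_le s r).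
Proof.
split=> [Sr s Ss a|Sr a]; last by apply: bigvee_le => _ [s Ss <-]; exact: Sr.
by apply: le_trans (Sr a); apply: bigvee_ub; exists s.
Qed.

Lemma srel_infP S r : srel_le r (srel_inf S) <-> (forall s, S s -> srel_le r s).
Proof.
split=> [rS s Ss a|rS a]; last by apply: bigvee_ub; exists r.
by apply: le_trans (rS a) _; apply: bigvee_le => _ [t tS <-]; exact: tS.
Qed.

Lemma srel_meetE s t a : srel_meet s t a = s a `&` t a.
Proof.
have p1 b b' : (s b `&` t b) `&` veq b b' <= s b' `&` t b'.
  by rewrite lexI; apply/andP; split; apply: (srelE (a := b)); le_meets.
have p2 b : s b `&` t b <= vext b by apply: leIxl; exact: srel_strict.
apply/le_anti/andP; split.
  by apply: bigvee_le => _ [r rS <-]; rewrite lexI !rS //=; [right|left].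
apply: bigvee_ub; exists (SRel p1 p2) => //= r [->|->] b; le_meets.
Qed.

Lemma srel_impP s t r :
  srel_le r (srel_imp s t) <-> srel_le (srel_meet r s) t.
Proof.
split=> [rst a|rst a]; last by apply: bigvee_ub; exists r.
rewrite srel_meetE; apply: le_trans (leI2 (rst a) (lexx _)) _.
rewrite meetC meet_bigvee; apply: bigvee_le => _ [_ [r' r'st <-] <-].
by rewrite meetC -srel_meetE.
Qed.

End Lattice.

Definition srel_ex A B (f : mor A B) (s : srel A) : srel B :=
  srel_inf [set r | srel_le s (pullback f r)].

Definition srel_all A B (f : mor A B) (s : srel A) : srel B :=
  srel_sup [set r | srel_le (pullback f r) s].

Lemma srel_exP A B (f : mor A B) (s : srel A) (r : srel B) :
  srel_le (srel_ex f s) r <-> srel_le s (pullback f r).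
Proof.
have le_pull (t : srel B) :
    (forall a b, f a b `&` s a <= t b) -> srel_le s (pullback f t).
  move=> fst a; rewrite -(meet_idPl (srel_strict s a)) (mor_total f).
  apply: meet_vee_le => b; apply: (vee_ge (i := b)).
  by rewrite lexI leIr meetC fst.
have pull_le (t : srel B) :
    srel_le s (pullback f t) -> forall a b, f a b `&` s a <= t b.
  move=> st a b; apply: le_trans (leI2 (lexx _) (st a)) _.
  apply: meet_vee_le => b'; apply: (srelE (a := b')); first by le_meets.
  by apply: (@morV _ _ _ _ f a); le_meets.
split=> [sr|sr a]; last exact: ((srel_infP _ (srel_ex f s)).1 (fun=> lexx _) r sr a).
apply: le_pull => a b; apply: le_trans (sr b).
have i1 b0 b' : vee (fun a => f a b0 `&` s a) `&` veq b0 b' <=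
                vee (fun a => f a b' `&` s a).
  apply: vee_meet_le => a0; apply: (vee_ge (i := a0)); rewrite lexI.
  apply/andP; split; last by le_meets.
  apply: (@morE _ _ _ _ f a0 a0 b0); try le_meets.
  by apply: (@mor_dom _ _ _ _ f a0 b0); le_meets.
have i2 b0 : vee (fun a => f a b0 `&` s a) <= vext b0.
  by apply: vee_le => a0; apply: (@mor_cod _ _ _ _ f a0); le_meets.
have /srel_infP/(_ b) : forall t, srel_le s (pullback f t) -> srel_le (SRel i1 i2) t.
  by move=> t /pull_le st b0; apply: vee_le => a0; exact: st.
by apply: le_trans; apply: (vee_ge (i := a)).
Qed.

Lemma srel_allP A B (f : mor A B) (s : srel A) (r : srel B) :
  srel_le r (srel_all f s) <-> srel_le (pullback f r) s.
Proof.
split=> [rs a|rs b]; last by apply: bigvee_ub; exists r.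
apply: vee_le => b; apply: le_trans (leI2 (lexx _) (rs b)) _.
rewrite meet_bigvee; apply: bigvee_le => _ [_ [t ts <-] <-].
by apply: le_trans (ts a); apply: (vee_ge (i := b)).
Qed.

End StrictRelations.

Record language : Type := Language {
  func : Type;
  func_ar : func -> nat;
  pred_symb : Type;
  pred_ar : pred_symb -> nat }.

(* Terms and formulas in a context of [n] variables.  A quantifier binds
   variable [ord0] of a formula in [n.+1] variables, the remaining ones being
   [lift ord0 i] for [i : 'I_n]. *)
Inductive term (L : language) (n : nat) : Type :=
| Var of 'I_n
| App (f : func L) of 'I_(func_ar f) -> term L n.

Inductive formula (L : language) : nat -> Type :=
| FBot n : formula L n
| FEq n : term L n -> term L n -> formula L n
| FRel n (R : pred_symb L) : ('I_(pred_ar R) -> term L n) -> formula L n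
| FAnd n : formula L n -> formula L n -> formula L n
| FOr n : formula L n -> formula L n -> formula L n
| FImp n : formula L n -> formula L n -> formula L n
| FAll n : formula L n.+1 -> formula L n
| FEx n : formula L n.+1 -> formula L n.

Arguments Var {L n}.
Arguments App {L n}.
Arguments FBot {L n}.

Definition FNot (L : language) (n : nat) (p : formula L n) : formula L n :=
  FImp p FBot.

Fixpoint godel (L : language) (n : nat) (p : formula L n) : formula L n :=
  match p with
  | FBot _ => FBot
  | FEq _ t u => FNot (FNot (FEq t u))
  | FRel _ R t => FNot (FNot (FRel t))
  | FAnd _ p q => FAnd (godel p) (godel q)
  | FOr _ p q => FNot (FAnd (FNot (godel p)) (FNot (godel q)))
  | FImp _ p q => FImp (godel p) (godel q)
  | FAll _ p => FAll (godel p)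
  | FEx _ p => FNot (FAll (FNot (godel p)))
  end.

Record structure (L : language) : Type := Structure {
  dom :> Type;
  func_interp : forall f : func L, ('I_(func_ar f) -> dom) -> dom;
  pred_interp : forall R : pred_symb L, ('I_(pred_ar R) -> dom) -> Prop }.

Fixpoint eval (L : language) (N : structure L) (n : nat) (e : 'I_n -> N)
    (t : term L n) : N :=
  match t with
  | Var i => e i
  | App f ts => func_interp (fun i => eval e (ts i))
  end.

Fixpoint sat (L : language) (N : structure L) (n : nat) (p : formula L n) :
    ('I_n -> N) -> Prop :=
  match p with
  | FBot _ => fun=> False
  | FEq _ t u => fun e => eval e t = eval e u
  | FRel _ R ts => fun e => pred_interp (fun i => eval e (ts i))
  | FAnd _ p q => fun e => sat p e /\ sat q e
  | FOr _ p q => fun e => sat p e \/ sat q e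
  | FImp _ p q => fun e => sat p e -> sat q e
  | FAll _ p => fun e => forall x : N, sat p (tcons x e)
  | FEx _ p => fun e => exists x : N, sat p (tcons x e)
  end.

Record vstructure (d : Order.disp_t) (O : frameType d) (L : language) : Type :=
  VStructure {
    vdom :> vset O;
    vfunc : forall f : func L, mor (power vdom (func_ar f)) vdom;
    vpred : forall R : pred_symb L, srel (power vdom (pred_ar R)) }.

Section Interpretation.
Context {d : Order.disp_t} {O : frameType d} {L : language}.
Variable M : vstructure O L.

Fixpoint interp_term n (t : term L n) : mor (power M n) M :=
  match t with
  | Var i => proj M i
  | App f ts => comp (vfunc M f) (tupling (fun i => interp_term (ts i)))
  end.

Section Diagonal.
Variable A : vset O.

Let dv (c : power A 2) : O := veq (c ord0) (c ord_max).

Let dv_veq c c' : dv c `&` veq c c' <= dv c'.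
Proof.
rewrite /dv; set x := (X in X <= _).
have x0 : x <= veq (c ord0) (c' ord0) by apply: leIxr; exact: power_le.
have x1 : x <= veq (c ord_max) (c' ord_max) by apply: leIxr; exact: power_le.
by apply: veqT (veqS x0) (veqT _ x1); exact: leIl.
Qed.

Let dv_strict c : dv c <= vext c.
Proof.
apply: le_power => i; rewrite /dv.
have [->|->] : i = ord0 \/ i = ord_max.
- by case: i => -[|[|[]]] // p; [left|right]; apply: val_inj.
- exact: veq_l (lexx _).
- exact: veq_r (lexx _).
Qed.

Definition diagonal : srel (power A 2) := SRel dv_veq dv_strict.

End Diagonal.

Definition tpair (T : Type) (x y : T) : 'I_2 -> T :=
  fun i => if i == ord0 then x else y.

(* Connectives are the Heyting operations of the poset of subobjects, and
   quantifiers the adjoints of pullback along [drop_proj]. *)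
Fixpoint interp n (p : formula L n) : srel (power M n) :=
  match p with
  | FBot n => srel_bot (power M n)
  | FEq _ t u =>
      pullback (tupling (tpair (interp_term t) (interp_term u))) (diagonal M)
  | FRel _ R ts => pullback (tupling (fun i => interp_term (ts i))) (vpred M R)
  | FAnd _ p q => srel_meet (interp p) (interp q)
  | FOr _ p q => srel_join (interp p) (interp q)
  | FImp _ p q => srel_imp (interp p) (interp q)
  | FAll n p => srel_all (drop_proj M n) (interp p)
  | FEx n p => srel_ex (drop_proj M n) (interp p)
  end.

Definition forcing n (p : formula L n) (a : 'I_n -> M) : O := interp p a.

Definition tuple_ext n (a : 'I_n -> M) : O := @vext d O (power M n) a.

Record representing_maps : Type := RepresentingMaps {
  rmap : forall f : func L, ('I_(func_ar f) -> M) -> M;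
  rmap_represents : forall f : func L,
    represents (A := power M (func_ar f)) (@rmap f) (vfunc M f);
  rmap_veq : forall (f : func L) (a a' : power M (func_ar f)),
    veq a a' <= veq (rmap a) (rmap a');
  rmap_ext : forall (f : func L) (a : 'I_(func_ar f) -> M),
    vext (rmap a) = tuple_ext a }.

End Interpretation.

Record lfilter (d : Order.disp_t) (O : frameType d) : Type := LFilter {
  lfilter_set :> O -> Prop;
  lfilter_top : lfilter_set \top;
  lfilter_meet : forall x y,
    lfilter_set x -> lfilter_set y -> lfilter_set (x `&` y);
  lfilter_up : forall x y, x <= y -> lfilter_set x -> lfilter_set y }.

Definition proper_lfilter (d : Order.disp_t) (O : frameType d)
  (F : lfilter O) : Prop := ~ F \bot.

Definition maximal_lfilter (d : Order.disp_t) (O : frameType d)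
    (F : lfilter O) : Prop :=
  proper_lfilter F /\
  forall G : lfilter O, proper_lfilter G ->
    (forall x, F x -> G x) -> forall x, G x -> F x.

Section Quotient.
Context {d : Order.disp_t} {O : frameType d} {L : language}.
Variables (M : vstructure O L) (h : representing_maps M) (F : lfilter O).

Definition feq (a b : M) : Prop := F (himp (vext a `|` vext b) (veq a b)).

Definition fclass (a : M) : set M := [set b | feq a b].

Lemma feq_refl a : feq a a.
Proof.
by apply: lfilter_up (lfilter_top F); rewrite le_himp meet1x joinxx.
Qed.

Lemma feq_sym a b : feq a b -> feq b a.
Proof. by rewrite /feq joinC veq_sym. Qed.

Lemma feq_trans a b c : feq a b -> feq b c -> feq a c.
Proof.
move=> Fab Fbc; apply: lfilter_up (lfilter_meet Fab Fbc).
rewrite le_himp meetUr leUx; set u := himp _ _; set v := himp _ _.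
have uP y : y <= u -> y <= vext a `|` vext b -> y <= veq a b.
  by rewrite le_himp => yu yab; apply: le_trans yu; rewrite lexI lexx.
have vP y : y <= v -> y <= vext b `|` vext c -> y <= veq b c.
  by rewrite le_himp => yv ybc; apply: le_trans yv; rewrite lexI lexx.
apply/andP; split; set y := (X in X <= _).
  have ab : y <= veq a b by apply: uP; [le_meets|rewrite lexUl //; le_meets].
  apply: veqT (ab) _; apply: vP; first by le_meets.
  by rewrite lexUl // (veq_r ab).
have bc : y <= veq b c by apply: vP; [le_meets|rewrite lexUr //; le_meets].
apply: veqT (bc); apply: uP; first by le_meets.
by rewrite lexUr // (veq_l bc).
Qed.

Lemma fclass_eq a b : fclass a = fclass b <-> feq a b.
Proof.
split=> [ab|ab]; first by have : fclass b b by [exact: feq_refl]; rewrite -ab.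
apply/seteqP; split=> c; first exact: feq_trans (feq_sym ab).
exact: feq_trans ab.
Qed.

Lemma feq_ext a b : F (vext a) -> feq a b <-> F (veq a b).
Proof.
move=> Fa; split=> [Fab|]; last by apply: lfilter_up; rewrite le_himp leIl.
apply: lfilter_up (lfilter_meet Fab Fa); set u := himp _ _.
have : u <= u by []; rewrite {2}/u le_himp; apply: le_trans.
by rewrite leI2 // leUl.
Qed.

Definition gcarrier : Type :=
  {C : set M | exists2 a, F (vext a) & C = fclass a}.

Definition gclass (a : M) (Fa : F (vext a)) : gcarrier :=
  exist _ (fclass a) (ex_intro2 _ _ a Fa erefl).

Definition grepr (c : gcarrier) : M := s2val (cid2 (svalP c)).

Lemma grepr_ext c : F (vext (grepr c)).
Proof. exact: (s2valP (cid2 (svalP c))). Qed.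

Lemma grepr_class c : sval c = fclass (grepr c).
Proof. exact: (s2valP' (cid2 (svalP c))). Qed.

Lemma tuple_extP n (a : 'I_n -> M) :
  (forall i, F (vext (a i))) <-> F (tuple_ext a).
Proof.
split=> Fa; last by move=> i; apply: lfilter_up Fa; exact: (@power_le d O M n).
apply: (big_ind (fun x => F x)) => [|x y|i _]; last exact: Fa.
  exact: lfilter_top.
exact: lfilter_meet.
Qed.

Lemma gfunc_subproof (f : func L) (c : 'I_(func_ar f) -> gcarrier) :
  F (vext (rmap h (fun i => grepr (c i)))).
Proof. by rewrite rmap_ext; apply/tuple_extP => i; exact: grepr_ext. Qed.

(* The operations are computed on chosen representatives; [gamma_func] and
   [gamma_pred] state their values on arbitrary ones. *)
Definition gamma : structure L := {|
  dom := gcarrier;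
  func_interp := fun f c => gclass (gfunc_subproof c);
  pred_interp := fun R c => F (vpred M R (fun i => grepr (c i))) |}.

Definition gtuple n (a : 'I_n -> M) (Fa : F (tuple_ext a)) : 'I_n -> gamma :=
  fun i => gclass ((tuple_extP a).2 Fa i).

Lemma grepr_gtuple n (a : 'I_n -> M) (Fa : F (tuple_ext a)) :
  F (@veq d O (power M n) a (fun i => grepr (gtuple Fa i))).
Proof.
have Fab i : F (veq (a i) (grepr (gtuple Fa i))).
  apply/feq_ext; first exact: ((tuple_extP a).2 Fa i).
  by apply/fclass_eq; rewrite -grepr_class.
apply: (big_ind (fun x => F x)) => [|x y|i _]; last exact: Fab.
  exact: lfilter_top.
exact: lfilter_meet.
Qed.

Lemma gamma_func (f : func L) (a : 'I_(func_ar f) -> M)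
    (Fa : F (tuple_ext a)) (Fha : F (vext (rmap h a))) :
  @func_interp L gamma f (gtuple Fa) = gclass Fha.
Proof.
apply: eq_exist; apply/fclass_eq/feq_sym/feq_ext => //.
by apply: lfilter_up (grepr_gtuple Fa); exact: rmap_veq.
Qed.

Lemma gamma_pred (R : pred_symb L) (a : 'I_(pred_ar R) -> M)
    (Fa : F (tuple_ext a)) :
  @pred_interp L gamma R (gtuple Fa) <-> F (vpred M R a).
Proof.
have Fab := grepr_gtuple Fa; split=> FR; apply: lfilter_up (lfilter_meet FR Fab).
  apply: (srelE (a := (fun i => grepr (gtuple Fa i)) : power M _)); first exact: leIl.
  by apply: veqS; exact: leIr.
exact: srel_veq.
Qed.

End Quotient.

Definition generic (d : Order.disp_t) (O : frameType d) (L : language)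
    (M : vstructure O L) (F : lfilter O) : Prop :=
  (forall n (p : formula L n) (a : 'I_n -> M), F (tuple_ext a) ->
     F (forcing (godel p) a) \/ F (forcing (FNot (godel p)) a)) /\
  (forall n (p : formula L n.+1) (a : 'I_n -> M), F (tuple_ext a) ->
     F (forcing (FEx (godel p)) a) ->
     exists b : M, F (forcing (godel p) (tcons b a))).

(* Main.v *)
(** For a maximal filter [m], every [x] satisfies [x \in m] or [hneg x \in m],
    so [m] is prime, contains [x] as soon as it contains its double negation,
    and the first half of genericity is automatic.  The second half, that [m]
    meets the witnesses of an existential as soon as it contains it, is a
    compactness statement: if no finite family of witnesses is dense in
    [E = ||exists v, phi^G||], the elements [E `&` hneg J], for [J] a finite
    join of witnesses, generate a proper filter, and a maximal one above it
    contains [E] but no witness.  This gives (i) <-> (ii).  Genericity is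
    exactly what the quantifier steps of Los's theorem need, the universal one
    being reduced to the existential one by the stability of [phi^G] under
    double negation; conversely Los's theorem for [exists v, phi] yields the
    witness. *)
Require Import Defs.
From mathcomp Require Import all_boot all_order.
From mathcomp Require Import boolp classical_sets.

Set Implicit Arguments.
Unset Strict Implicit.
Unset Printing Implicit Defensive.

Import Order.TTheory.
Local Open Scope classical_set_scope.
Local Open Scope order_scope.

(** * Pseudocomplements in a frame *)

Section Negation.
Context {d : Order.disp_t} {O : frameType d}.
Implicit Types x y : O.

Lemma le_hneg x y : (x <= hneg y) = (x `&` y <= \bot).
Proof. exact: le_himp. Qed.

Lemma hneg_meet x : hneg x `&` x <= \bot.
Proof. by rewrite -le_hneg. Qed.

Lemma le_hneg2 x y : x <= y -> hneg y <= hneg x.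
Proof. by move=> xy; rewrite le_hneg (le_trans (leI2 (lexx _) xy)) ?hneg_meet. Qed.

(** Contraposing twice with the parameter [x] held fixed. The parameter will be the value of an
    implication or the extent of a bound variable. *)
Lemma hneg2_meet x y z : x `&` y <= z -> x `&` hneg (hneg y) <= hneg (hneg z).
Proof.
move=> xyz; have xzy : x `&` hneg z <= hneg y.
  by rewrite le_hneg meetAC (le_trans (leI2 xyz (lexx _))) // meetC hneg_meet.
rewrite le_hneg meetAC (le_trans (leI2 xzy (lexx _))) //.
by rewrite meetC hneg_meet.
Qed.

Lemma hneg2_bot : hneg (hneg \bot) <= \bot :> O.
Proof. by apply: le_trans (hneg_meet (hneg \bot)); rewrite lexI lexx le_hneg leIr. Qed.

End Negation.

(** * Maximal filters: primeness, existence, and dense finite subcovers *)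

Section MaximalFilters.
Context {d : Order.disp_t} {O : frameType d}.
Implicit Types (x y : O) (F G m : lfilter O).

Lemma lfilter_meetP F x y : F (x `&` y) <-> F x /\ F y.
Proof.
split=> [Fxy|[Fx Fy]]; last exact: lfilter_meet.
by split; apply: lfilter_up Fxy; [exact: leIl|exact: leIr].
Qed.

Section Adjoin.
Variables (F : lfilter O) (x : O).

Let av y := exists2 z, F z & z `&` x <= y.

Let av_top : av \top.
Proof. by exists \top; [exact: lfilter_top|exact: lex1]. Qed.

Let av_meet y y' : av y -> av y' -> av (y `&` y').
Proof.
move=> [z Fz zy] [z' Fz' zy']; exists (z `&` z'); first exact: lfilter_meet.
by rewrite lexI (le_trans _ zy) ?(le_trans _ zy') ?leI2 ?leIl ?leIr.
Qed.

Let av_up y y' : y <= y' -> av y -> av y'.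
Proof. by move=> yy' [z Fz zy]; exists z => //; exact: le_trans yy'. Qed.

Definition lfilter_adjoin : lfilter O := LFilter av_top av_meet av_up.

End Adjoin.

(** If [hneg x] is not in [m], the filter generated by [m] and [x] is proper, because [z] meeting
    [x] in [\bot] means [z <= hneg x]; maximality then puts [x] in [m]. *)
Lemma maximal_em m x : maximal_lfilter m -> m x \/ m (hneg x).
Proof.
move=> [_ mM]; case: (EM (m (hneg x))) => [|mNx]; [by right|left].
apply: (mM (lfilter_adjoin m x)) => [[z mz zx]|y my|].
- by apply: mNx; apply: lfilter_up mz; rewrite le_hneg.
- by exists y => //; exact: leIl.
- by exists \top; [exact: lfilter_top|exact: leIr].
Qed.

Lemma maximal_hneg m x : maximal_lfilter m -> m (hneg x) <-> ~ m x.
Proof.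
move=> mm; split=> [mNx mx|mx]; last by case: (maximal_em x mm).
by apply: mm.1; apply: lfilter_up (hneg_meet x) (lfilter_meet mNx mx).
Qed.

Lemma maximal_join m x y : maximal_lfilter m -> m (x `|` y) -> m x \/ m y.
Proof.
move=> mm mxy; case: (maximal_em x mm) => [|mNx]; [by left|right].
apply: lfilter_up (lfilter_meet mNx mxy).
by rewrite meetUr leUx leIr andbT (le_trans (hneg_meet x)) ?le0x.
Qed.

Lemma maximal_bigjoin m I (s : seq I) (G : I -> O) : maximal_lfilter m ->
  m (\join_(i <- s) G i) -> exists i, m (G i).
Proof.
move=> mm; elim: s => [|i s IH]; first by rewrite big_nil => /mm.1.
by rewrite big_cons => /(maximal_join mm) [|/IH//]; exists i.
Qed.

Section Union.
Variables (S : set (lfilter O)) (F0 : lfilter O).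
Hypotheses (S0 : S F0)
  (S_total : forall F G, S F -> S G ->
    (forall x, F x -> G x) \/ (forall x, G x -> F x)).

Let uv x := exists2 F, S F & F x.

Let uv_top : uv \top. Proof. by exists F0 => //; exact: lfilter_top. Qed.

Let uv_meet x y : uv x -> uv y -> uv (x `&` y).
Proof.
move=> [F SF Fx] [G SG Gy]; case: (S_total SF SG) => FG.
  by exists G => //; apply: lfilter_meet => //; exact: FG.
by exists F => //; apply: lfilter_meet => //; exact: FG.
Qed.

Let uv_up x y : x <= y -> uv x -> uv y.
Proof. by move=> xy [F SF Fx]; exists F => //; exact: lfilter_up xy Fx. Qed.

Definition lfilter_union : lfilter O := LFilter uv_top uv_meet uv_up.

End Union.

(** Zorn's lemma on the proper filters containing [F], ordered by inclusion. *)
Lemma maximal_extension F : proper_lfilter F ->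
  exists2 m, maximal_lfilter m & forall x, F x -> m x.
Proof.
move=> F_proper.
pose P G := proper_lfilter G /\ forall x, F x -> G x.
pose T := {G | P G}.
pose R (G H : T) := `[< forall x, sval G x -> sval H x >].
have t0 : T by exists F.
have [||A A_total|[m [m_proper Fm]] mM] := @ZL_preorder T t0 R.
- by move=> G; apply/asboolP.
- by move=> G H K /asboolP GH /asboolP HK; apply/asboolP => x /GH /HK.
(* A union of filters contains [\top] only when the chain has a member; the empty chain is bounded
   by any element, here [t0]. *)
- case: (pselect (exists G : T, A G)) => [[G AG]|A0]; last first.
    by exists t0 => G AG; case: A0; exists G.
  have S_total H K : (sval @` A) H -> (sval @` A) K ->
      (forall x, H x -> K x) \/ (forall x, K x -> H x).
    move=> [H' AH <-] [K' AK <-].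
    by case: (A_total H' K' AH AK) => /asboolP; [left|right].
  have SG : (sval @` A) (sval G) by exists G.
  have U_proper : proper_lfilter (lfilter_union SG S_total).
    by move=> [_ [H _ <-]]; exact: (svalP H).1.
  have FU x : F x -> lfilter_union SG S_total x.
    by move=> Fx; exists (sval G) => //; exact: (svalP G).2.
  exists (exist P _ (conj U_proper FU)) => H AH; apply/asboolP => x Hx.
  by exists (sval H) => //; exists H.
(* A proper filter above [m] is also above [F], so maximality among the filters containing [F] is
   maximality outright. *)
- exists m => //; split=> // G G_proper mG.
  pose G' : T := exist P G (conj G_proper (fun x Fx => mG x (Fm x Fx))).
  exact: (elimT (asboolP _) (mM G' (introT (asboolP _) mG))).
Qed.

Section DenseSubcover.
Variables (I : Type) (E : O) (G : I -> O).

Let cv x := exists s : seq I, E `&` hneg (\join_(i <- s) G i) <= x.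

Let cv_top : cv \top. Proof. by exists [::]; exact: lex1. Qed.

Let cv_meet x y : cv x -> cv y -> cv (x `&` y).
Proof.
move=> [s sx] [t ty]; exists (s ++ t); rewrite big_cat /= lexI.
by rewrite (le_trans _ sx) ?(le_trans _ ty) // leI2 // le_hneg2 ?leUl ?leUr.
Qed.

Let cv_up x y : x <= y -> cv x -> cv y.
Proof. by move=> xy [s sx]; exists s; exact: le_trans xy. Qed.

Lemma maximal_dense_subcover :
  (forall m, maximal_lfilter m -> m E -> exists i, m (G i)) ->
  exists s : seq I, E <= hneg (hneg (\join_(i <- s) G i)).
Proof.
move=> EG; pose F := LFilter cv_top cv_meet cv_up.
have [[s sE]|F_proper] := EM (F \bot); first by exists s; rewrite le_hneg.
have [m mm Fm] := maximal_extension F_proper.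
(* The empty list puts [E] in [F], and a singleton list puts each [hneg (G i)] there, so [m] cannot
   contain any [G i]. *)
have /(EG m mm)[i mGi] : m E by apply: Fm; exists [::]; exact: leIl.
have : m (hneg (G i)) by apply: Fm; exists [:: i]; rewrite big_seq1 leIr.
by move/(maximal_hneg _ mm).
Qed.

End DenseSubcover.
End MaximalFilters.

(** * Pointwise values of the operations on subobjects *)

Section StrictRelationValues.
Context {d : Order.disp_t} {O : frameType d}.
Implicit Types (A B C : vset O) (x : O).

Section Point.
Variables (A : vset O) (a : A) (x : O).

Let pv b := x `&` veq a b.

Let pv_veq b b' : pv b `&` veq b b' <= pv b'.
Proof.
rewrite lexI; apply/andP; split; first by le_meets.
by apply: (@veqT _ _ _ _ b); le_meets.
Qed.

Let pv_strict b : pv b <= vext b.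
Proof. by apply: (@veq_r _ _ _ a); le_meets. Qed.

(* The least strict relation of value at least [x `&` vext a] at [a]. *)
Definition srel_point : srel A := SRel pv_veq pv_strict.

End Point.

Lemma srel_botE A (a : A) : srel_bot A a = \bot.
Proof. by apply/le_anti; rewrite le0x andbT; apply: bigvee_le => _ [s []]. Qed.

(** [srel_imp] is a supremum of strict relations, so a lower bound on its value at [a] is obtained
    by testing it against [srel_point a x]: compatibility with [veq] spreads the inequality at [a]
    to every other point. *)
Lemma le_srel_imp A (s t : srel A) a x :
  x <= srel_imp s t a <-> x <= vext a /\ x `&` s a <= t a.
Proof.
split=> [xst|[xa xst]].
  split; first exact: le_trans xst (srel_strict _ _).
  apply: le_trans (leI2 xst (lexx _)) _; rewrite -srel_meetE.
  by move: a {xst}; apply/srel_impP => a.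
have /srel_impP/(_ a) : srel_le (srel_meet (srel_point a x) s) t.
  move=> b; rewrite srel_meetE; apply: (@srelE _ _ _ _ a); last by le_meets.
  apply: le_trans xst; rewrite lexI; apply/andP; split; first by le_meets.
  by apply: (@srelE _ _ _ _ b); [le_meets|apply: veqS; le_meets].
by apply: le_trans; rewrite lexI lexx.
Qed.

(** The counit of the adjunction gives one direction; the test relation [srel_point b x], pulled
    back along [f], gives the other. *)
Lemma le_srel_all A B (f : mor A B) (s : srel A) b x :
  x <= srel_all f s b <-> x <= vext b /\ forall a, x `&` f a b <= s a.
Proof.
split=> [xs|[xb xs]].
  split=> [|a]; first exact: le_trans xs (srel_strict _ _).
  have /srel_allP/(_ a) : srel_le (srel_all f s) (srel_all f s) by move=> ?.
  by apply: le_trans; apply: (vee_ge (i := b)); rewrite meetC leI2.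
have /srel_allP/(_ b) : srel_le (pullback f (srel_point b x)) s.
  move=> a; apply: vee_le => b'; apply: le_trans (xs a).
  rewrite lexI; apply/andP; split; first by le_meets.
  apply: (@morE _ _ _ _ f a a b'); last by apply: veqS; le_meets.
    by apply: (@mor_dom _ _ _ _ f a b'); le_meets.
  by le_meets.
by apply: le_trans; rewrite lexI lexx.
Qed.

(** The join on the right is one of the strict relations whose infimum defines [srel_ex]. The
    reverse inequality comes from the unit of the adjunction and the single-valuedness of [f]. *)
Lemma srel_exE A B (f : mor A B) (s : srel A) b :
  srel_ex f s b = vee (fun a => f a b `&` s a).
Proof.
have v1 b1 b2 : vee (fun a => f a b1 `&` s a) `&` veq b1 b2 <=
                vee (fun a => f a b2 `&` s a).
  apply: vee_meet_le => a; apply: (vee_ge (i := a)); rewrite lexI.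
  apply/andP; split; last by le_meets.
  apply: (@morE _ _ _ _ f a a b1); try le_meets.
  by apply: (@mor_dom _ _ _ _ f a b1); le_meets.
have v2 b1 : vee (fun a => f a b1 `&` s a) <= vext b1.
  by apply: vee_le => a; apply: (@mor_cod _ _ _ _ f a); le_meets.
apply/le_anti/andP; split.
  suff: srel_le (srel_ex f s) (SRel v1 v2) by apply.
  apply/srel_exP => a; rewrite -(meet_idPl (srel_strict s a)) (mor_total f).
  apply: meet_vee_le => c; apply: (vee_ge (i := c)).
  by rewrite lexI leIr; apply: (vee_ge (i := a)); rewrite meetC.
apply: vee_le => a.
have /srel_exP/(_ a) : srel_le (srel_ex f s) (srel_ex f s) by move=> ?.
move=> sa; apply: le_trans (leI2 (lexx _) sa) _.
apply: meet_vee_le => c; apply: (@srelE _ _ _ _ c); first by le_meets.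
by apply: (@morV _ _ _ _ f a); le_meets.
Qed.

Lemma represents_ext A B (k : A -> B) (f : mor A B) :
  represents k f -> forall a, vext a <= vext (k a).
Proof.
move=> fk a; rewrite {1}(mor_total f); apply: vee_le => b.
by rewrite fk; apply: (@veq_l _ _ _ _ b); le_meets.
Qed.

(** [f a (k a)] has value at least [vext a]; transport along [veq a a'] gives [f a' (k a)], which
    unfolds to [veq (k a') (k a)]. *)
Lemma represents_veq A B (k : A -> B) (f : mor A B) :
  represents k f -> forall a a', veq a a' <= veq (k a) (k a').
Proof.
move=> fk a a'; set x := veq a a'.
have xa : x <= vext a by exact: veq_l (lexx _).
have xka := le_trans xa (represents_ext fk a).
have : x <= f a' (k a).
  by apply: (@morE _ _ _ _ f a a' (k a)) => //; rewrite fk lexI xa xka.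
by rewrite fk lexI => /andP[_]; exact: veqS.
Qed.

Lemma represents_comp A B C (k : A -> B) (l : B -> C) (f : mor A B) (g : mor B C) :
  represents k f -> represents l g -> represents (fun a => l (k a)) (Defs.comp g f).
Proof.
move=> fk gl a c; apply/le_anti/andP; split.
  apply: vee_le => b; rewrite fk gl lexI; apply/andP; split; first by le_meets.
  apply: (@veqT _ _ _ _ (l b)); last by le_meets.
  by apply: le_trans (represents_veq gl _ _); le_meets.
apply: (vee_ge (i := k a)); rewrite fk gl.
have := represents_ext fk a => ka.
by rewrite !lexI leIl leIr (le_trans (leIl _ _) ka).
Qed.

Lemma represents_tupling A B n (k : 'I_n -> B -> A) (f : 'I_n -> mor B A) :
  (forall i, represents (k i) (f i)) ->
  represents (B := power A n) (fun b i => k i b) (tupling f).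
Proof.
move=> fk b a; rewrite /tupling /=; apply/le_anti/andP; split.
  rewrite leI2 //; apply: le_bigmeet => i.
  apply: le_trans (bigmeet_le _ i) _; rewrite fk; exact: leIr.
rewrite lexI leIl; apply: le_bigmeet => i; rewrite fk leI2 //.
exact: (bigmeet_le (fun i => veq (k i b) (a i))).
Qed.

(** The factor [vext a] restores strictness, since [k a] may exist to a larger extent than [a]. *)
Lemma pullback_represents A B (k : A -> B) (f : mor A B) (t : srel B) :
  represents k f -> forall a, pullback f t a = vext a `&` t (k a).
Proof.
move=> fk a; apply/le_anti/andP; split.
  apply: vee_le => b; rewrite fk lexI; apply/andP; split; first by le_meets.
  by apply: (@srelE _ _ _ _ b); [le_meets|apply: veqS; le_meets].
apply: (vee_ge (i := k a)); rewrite fk !lexI leIl leIr !andbT /=.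
exact: le_trans (leIl _ _) (represents_ext fk a).
Qed.

Lemma ttail_tcons (T : Type) n (b : T) (a : 'I_n -> T) : ttail (tcons b a) = a.
Proof. by apply/funext => i; rewrite /ttail /tcons liftK. Qed.

Lemma tcons_ttail (T : Type) n (c : 'I_n.+1 -> T) : tcons (c ord0) (ttail c) = c.
Proof. by apply/funext => i; rewrite /tcons; case: unliftP => [j|] ->. Qed.

Lemma veq_tcons A n (b b' : A) (a a' : power A n) :
  @veq d O (power A n.+1) (tcons b a) (tcons b' a') = veq b b' `&` veq a a'.
Proof.
rewrite /= big_ord_recl /tcons unlift_none /=; congr (_ `&` _).
by apply: eq_bigr => i _; rewrite liftK.
Qed.

End StrictRelationValues.

(** * Recursive clauses for forcing values, and stability of the translation *)

Section Forcing.
Context {d : Order.disp_t} {O : frameType d} {L : language}.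
Variable M : vstructure O L.
Implicit Types x : O.

Lemma forcing_ext n (p : formula L n) (a : 'I_n -> M) : forcing p a <= tuple_ext a.
Proof. exact: srel_strict. Qed.

Lemma forcing_bot n (a : 'I_n -> M) : forcing FBot a = \bot.
Proof. exact: srel_botE. Qed.

Lemma forcing_and n (p q : formula L n) (a : 'I_n -> M) :
  forcing (FAnd p q) a = forcing p a `&` forcing q a.
Proof. exact: srel_meetE. Qed.

Lemma forcing_imp n (p q : formula L n) (a : 'I_n -> M) :
  forcing (FImp p q) a = tuple_ext a `&` himp (forcing p a) (forcing q a).
Proof.
apply/le_anti/andP; split.
  have /le_srel_imp[? ?] := lexx (forcing (FImp p q) a).
  by rewrite lexI le_himp; apply/andP.
by apply/le_srel_imp; split; [exact: leIl|rewrite -le_himp leIr].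
Qed.

Lemma forcing_not n (p : formula L n) (a : 'I_n -> M) :
  forcing (FNot p) a = tuple_ext a `&` hneg (forcing p a).
Proof. by rewrite forcing_imp forcing_bot. Qed.

Lemma tuple_ext_tcons n (b : M) (a : 'I_n -> M) :
  tuple_ext (tcons b a) = vext b `&` tuple_ext a.
Proof. exact: veq_tcons. Qed.

(** The adjunction quantifies over all tuples [c] of length [n.+1] whose tail agrees with [a];
    transport along that agreement reduces them to the tuples [tcons b a]. *)
Lemma le_forcing_all n (p : formula L n.+1) (a : 'I_n -> M) x :
  x <= forcing (FAll p) a <->
  x <= tuple_ext a /\ forall b, x `&` vext b <= forcing p (tcons b a).
Proof.
apply: (iff_trans (le_srel_all _ _ (a : power M n) x)).
split=> -[xa xp]; split=> //; [move=> b|move=> c].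
  apply: le_trans (xp (tcons b a)); rewrite /= ttail_tcons.
  rewrite -[X in _ <= _ `&` (X `&` _)]/(tuple_ext (tcons b a)) tuple_ext_tcons.
  by rewrite !lexI leIl leIr !(le_trans (leIl _ _) xa).
rewrite -{2}(tcons_ttail c).
apply: (@srelE _ _ _ _ (tcons (c ord0) a : power M n.+1)).
  apply: le_trans (xp (c ord0)); rewrite leI2 //=; apply: leIxl.
  exact: power_le.
rewrite veq_tcons lexI; apply/andP; split; last by apply: veqS; le_meets.
by apply: leIxr; apply: leIxl; exact: power_le.
Qed.

Lemma forcing_ex n (p : formula L n.+1) (a : 'I_n -> M) :
  forcing (FEx p) a = vee (fun b => forcing p (tcons b a)).
Proof.
rewrite [LHS](srel_exE _ _ (a : power M n)); apply/le_anti/andP; split.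
  apply: vee_le => c; apply: (vee_ge (i := c ord0)).
  apply: (@srelE _ _ _ _ c); first exact: leIr.
  rewrite -[X in _ <= veq X _](tcons_ttail c) veq_tcons lexI /=.
  apply/andP; split; last by le_meets.
  by do 2 apply: leIxl; exact: power_le.
apply: vee_le => b; apply: (vee_ge (i := tcons b a)).
have pb := forcing_ext p (tcons b a).
rewrite /= ttail_tcons !lexI lexx (le_trans pb) //=.
by rewrite andbT (le_trans pb) // tuple_ext_tcons leIr.
Qed.

(** Translated atoms, disjunctions and existentials are negations, hence stable; conjunction,
    implication and universal quantification inherit stability. The extent is a factor because every
    forcing value lies below it. *)
Lemma godel_stable n (p : formula L n) (a : 'I_n -> M) :
  tuple_ext a `&` hneg (hneg (forcing (godel p) a)) <= forcing (godel p) a.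
Proof.
(* Triple negation collapses to single negation, relative to the extent of the tuple. *)
have stable_not k (q : formula L k) (c : 'I_k -> M) :
    tuple_ext c `&` hneg (hneg (forcing (FNot q) c)) <= forcing (FNot q) c.
  rewrite [X in _ <= X]forcing_not lexI leIl /= le_hneg.
  set x := (X in X <= _); have xN : x <= hneg (hneg (forcing (FNot q) c)) by le_meets.
  apply: le_trans (hneg_meet (hneg (forcing (FNot q) c))).
  rewrite lexI xN le_hneg forcing_not /=.
  by apply: le_trans (hneg_meet (forcing q c)); le_meets.
elim: p a => {n} /= [n a|n t u a|n R t a|n p IHp q IHq a
    |n p IHp q IHq a|n p IHp q IHq a|n p IHp a|n p IHp a].
- by rewrite forcing_bot leIxr ?hneg2_bot.
- exact: stable_not.
- exact: stable_not.
- rewrite forcing_and lexI; apply/andP; split.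
    apply: le_trans (IHp a); rewrite leI2 //; do 2 apply: le_hneg2; exact: leIl.
  apply: le_trans (IHq a); rewrite leI2 //; do 2 apply: le_hneg2; exact: leIr.
- exact: stable_not.
- rewrite [X in _ <= X]forcing_imp lexI leIl /= le_himp.
  apply: le_trans (IHq a); rewrite -meetA leI2 // meetC hneg2_meet //.
  by rewrite forcing_imp meetC -le_himp leIr.
- apply/le_forcing_all; split=> [|b]; first exact: leIl.
  have /le_forcing_all[_ /(_ b)] := lexx (forcing (FAll (godel p)) a).
  rewrite meetC => /hneg2_meet pb; apply: le_trans (IHp (tcons b a)).
  rewrite tuple_ext_tcons !lexI leIr -!andbA /=; apply/andP; split; first by le_meets.
  by apply: le_trans pb; le_meets.
- exact: stable_not.
Qed.

End Forcing.

(** * Terms in the quotient, and the theorem of Los *)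

Section Los.
Context {d : Order.disp_t} {O : frameType d} {L : language}.
Variables (M : vstructure O L) (h : representing_maps M).

Fixpoint term_val n (a : 'I_n -> M) (t : term L n) : M :=
  match t with
  | Var i => a i
  | App f ts => rmap h (fun i => term_val a (ts i))
  end.

Lemma represents_term n (t : term L n) :
  represents (A := power M n) (fun a => term_val a t) (interp_term M t).
Proof.
elim: t => [i|f ts IH]; first exact: rep_morP.
have tsP := represents_tupling (fun i => IH i).
exact: (represents_comp tsP (@rmap_represents _ _ _ _ h f)).
Qed.

Lemma forcing_eq n (t u : term L n) (a : 'I_n -> M) :
  forcing (FEq t u) a = tuple_ext a `&` veq (term_val a t) (term_val a u).
Proof.
have tu i : represents (A := power M n) (fun a => term_val a (tpair t u i))
    (tpair (interp_term M t) (interp_term M u) i).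
  by rewrite /tpair; case: ifP => _; exact: represents_term.
exact: (pullback_represents _ (represents_tupling tu)).
Qed.

Lemma forcing_rel n (R : pred_symb L) (ts : 'I_(pred_ar R) -> term L n)
    (a : 'I_n -> M) :
  forcing (FRel ts) a = tuple_ext a `&` vpred M R (fun i => term_val a (ts i)).
Proof.
have tsP i := represents_term (ts i).
exact: (pullback_represents _ (represents_tupling tsP)).
Qed.

Variable m : lfilter O.

Lemma term_val_ext n (a : 'I_n -> M) (t : term L n) :
  m (tuple_ext a) -> m (vext (term_val a t)).
Proof. by apply: lfilter_up; exact: (represents_ext (represents_term t)). Qed.

Lemma gclassE (a b : M) (ma : m (vext a)) (mb : m (vext b)) :
  gclass ma = gclass mb <-> m (veq a b).
Proof.
rewrite -(feq_ext _ ma) -fclass_eq; split=> [[]//|ab].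
exact: eq_exist.
Qed.

Lemma gclass_irr (a : M) (ma ma' : m (vext a)) : gclass ma = gclass ma'.
Proof. exact/gclassE. Qed.

Lemma gclass_grepr (c : gcarrier M m) : gclass (grepr_ext c) = c.
Proof. by case: c => C CP; apply: eq_exist; rewrite -grepr_class. Qed.

Lemma eval_gtuple n (a : 'I_n -> M) (ma : m (tuple_ext a)) (t : term L n) :
  eval (gtuple h ma) t = gclass (term_val_ext t ma).
Proof.
elim: t => [i|f ts IH]; first exact: gclass_irr.
have mts : m (tuple_ext (fun i => term_val a (ts i))).
  by apply/tuple_extP => i; exact: term_val_ext.
(* [func_interp] works on chosen representatives; recognising the arguments as a [gtuple] lets
   [gamma_func] compute it on the given ones. *)
rewrite -[LHS]/(@func_interp L (gamma h m) f (fun i => eval (gtuple h ma) (ts i))).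
rewrite (_ : (fun i => _) = gtuple h mts); first exact: gamma_func.
by apply/funext => i; rewrite IH; exact: gclass_irr.
Qed.

Lemma gtuple_tcons n (a : 'I_n -> M) (b : M) (ma : m (tuple_ext a))
    (mb : m (vext b)) (mba : m (tuple_ext (tcons b a))) :
  tcons (gclass mb : gamma h m) (gtuple h ma) = gtuple h mba.
Proof.
apply/funext => i; rewrite [RHS]/gtuple; move: (_.2 mba i).
by rewrite /tcons; case: (unlift ord0 i) => [j|] mi; exact: gclass_irr.
Qed.

(** * Truth clauses at a maximal filter *)

Hypothesis m_max : maximal_lfilter m.

Lemma maximal_forcing_not n (p : formula L n) (a : 'I_n -> M) :
  m (tuple_ext a) -> m (forcing (FNot p) a) <-> ~ m (forcing p a).
Proof.
move=> ma; rewrite forcing_not -(maximal_hneg _ m_max).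
by split=> [/lfilter_meetP[]|] //; exact: lfilter_meet.
Qed.

Lemma maximal_forcing_imp n (p q : formula L n) (a : 'I_n -> M) :
  m (tuple_ext a) ->
  m (forcing (FImp p q) a) <-> (m (forcing p a) -> m (forcing q a)).
Proof.
move=> ma; rewrite forcing_imp; split=> [/lfilter_meetP[_ mpq] mp|mpq].
  by apply: lfilter_up (lfilter_meet mpq mp); rewrite -le_himp.
apply: lfilter_meet => //; case: (maximal_em (forcing p a) m_max) => [/mpq|].
  by apply: lfilter_up; rewrite le_himp leIl.
by apply: lfilter_up; rewrite le_himp (le_trans (hneg_meet _)) ?le0x.
Qed.

Lemma maximal_godel_em n (p : formula L n) (a : 'I_n -> M) : m (tuple_ext a) ->
  m (forcing (godel p) a) \/ m (forcing (FNot (godel p)) a).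
Proof.
move=> ma; case: (EM (m (forcing (godel p) a))); first by left.
by right; apply/maximal_forcing_not.
Qed.

(** In any frame [FAll] of a negation and the negation of [FEx] have the same value, so the
    translated existential is the double negation of [FEx (godel p)], and a maximal filter does not
    distinguish the two. *)
Lemma maximal_godel_ex n (p : formula L n.+1) (a : 'I_n -> M) :
  m (tuple_ext a) ->
  m (forcing (godel (FEx p)) a) <-> m (forcing (FEx (godel p)) a).
Proof.
move=> ma /=.
have all_notE : forcing (FAll (FNot (godel p))) a = forcing (FNot (FEx (godel p))) a.
  apply/le_anti/andP; split.
    have /le_forcing_all[xa xp] := lexx (forcing (FAll (FNot (godel p))) a).
    rewrite [X in _ <= X]forcing_not lexI xa le_hneg forcing_ex.
    apply: meet_vee_le => b; set y := forcing (godel p) _.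
    have yb : y <= vext b.
      by apply: le_trans (forcing_ext _ _) _; rewrite tuple_ext_tcons leIl.
    apply: le_trans (hneg_meet y); rewrite lexI leIr andbT.
    apply: le_trans (leI2 (lexx _) yb) _; apply: le_trans (xp b) _.
    by rewrite forcing_not leIr.
  apply/le_forcing_all; rewrite forcing_not; split=> [|b]; first exact: leIl.
  rewrite forcing_not tuple_ext_tcons !lexI leIr -!andbA /=.
  apply/andP; split; first by le_meets.
  apply: leIxl; apply: leIxr; apply: le_hneg2; rewrite forcing_ex.
  exact: (vee_ub (fun b => _)).
rewrite maximal_forcing_not // all_notE maximal_forcing_not //.
by split=> [/contrapT|mE]; [|apply].
Qed.

Hypothesis m_ex : forall n (p : formula L n.+1) (a : 'I_n -> M),
  m (tuple_ext a) -> m (forcing (FEx (godel p)) a) ->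
  exists b : M, m (forcing (godel p) (tcons b a)).

(** For the converse, a counterexample would be a witness of [FEx (godel (FNot p))]. Having none,
    [m] contains the negation of that existential, which by stability lies below the universal
    formula. *)
Lemma maximal_forcing_all n (p : formula L n.+1) (a : 'I_n -> M) :
  m (tuple_ext a) ->
  m (forcing (FAll (godel p)) a) <->
  (forall b, m (vext b) -> m (forcing (godel p) (tcons b a))).
Proof.
move=> ma; split=> [mp b mb|mp].
  have /le_forcing_all[_ /(_ b)] := lexx (forcing (FAll (godel p)) a).
  by move/lfilter_up; apply; exact: lfilter_meet.
(* [godel (FNot p)] computes to [FNot (godel p)], so [m_ex] covers existentials of negations. *)
have mE : ~ m (forcing (FEx (godel (FNot p))) a).
  move=> /(m_ex ma)[b mNp].
  have mba : m (tuple_ext (tcons b a)) by apply: lfilter_up (forcing_ext _ _) mNp.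
  move/(maximal_forcing_not _ mba): mNp; apply; apply: mp.
  by move: mba; rewrite tuple_ext_tcons => /lfilter_meetP[].
have /lfilter_up : forcing (FNot (FEx (godel (FNot p)))) a <= forcing (FAll (godel p)) a.
  apply/le_forcing_all; split=> [|b]; first exact: forcing_ext.
  (* Stability reduces the goal to a double negation, so its negation [y] may be assumed; it makes
     [b] a witness of the existential denied by [x]. *)
  apply: le_trans (godel_stable p (tcons b a)).
  rewrite forcing_not tuple_ext_tcons !lexI leIr -!andbA /=.
  set x := (X in (X <= _) && _); have xa : x <= tuple_ext a by rewrite /x; le_meets.
  rewrite xa /= le_hneg; set y := hneg (forcing (godel p) _).
  have xb : x <= vext b by exact: leIr.
  have xy : x `&` y <= forcing (godel (FNot p)) (tcons b a).
    rewrite [X in _ <= X]forcing_not tuple_ext_tcons !lexI leIr.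
    by rewrite !(le_trans (leIl x y)).
  set e := forcing (FEx _) a in x xa xb xy *.
  have xye : x `&` y <= e.
    by apply: le_trans xy _; rewrite /e forcing_ex; exact: (vee_ub (fun b => _)).
  by apply: le_trans (hneg_meet e); rewrite lexI xye andbT /x; le_meets.
by apply; apply/maximal_forcing_not.
Qed.

Lemma los n (p : formula L n) (a : 'I_n -> M) (ma : m (tuple_ext a)) :
  sat p (gtuple h ma) <-> m (forcing (godel p) a).
Proof.
have tconsP k (c : 'I_k -> M) b : m (tuple_ext c) -> m (vext b) ->
    m (tuple_ext (tcons b c)).
  by move=> mc mb; rewrite tuple_ext_tcons; exact: lfilter_meet.
have not2P k (q : formula L k) (c : 'I_k -> M) : m (tuple_ext c) ->
    m (forcing (FNot (FNot q)) c) <-> m (forcing q c).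
  by move=> mc; rewrite !maximal_forcing_not // notK.
elim: p a ma => {n} [n a ma|n t u a ma|n R ts a ma|n p IHp q IHq a ma
    |n p IHp q IHq a ma|n p IHp q IHq a ma|n p IHp a ma|n p IHp a ma].
- by rewrite /= forcing_bot; split=> // /m_max.1.
- rewrite /= not2P // forcing_eq !eval_gtuple gclassE.
  by split=> [?|/lfilter_meetP[]//]; exact: lfilter_meet.
- rewrite [godel _]/= not2P // forcing_rel.
  have mts : m (tuple_ext (fun i => term_val a (ts i))).
    by apply/tuple_extP => i; exact: term_val_ext.
  rewrite -[sat _ _]/(@pred_interp L (gamma h m) R (fun i => eval (gtuple h ma) (ts i))).
  rewrite (_ : (fun i => _) = gtuple h mts); last first.
    by apply/funext => i; rewrite eval_gtuple; exact: gclass_irr.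
  rewrite gamma_pred.
  by split=> [?|/lfilter_meetP[]//]; exact: lfilter_meet.
- by rewrite /= forcing_and lfilter_meetP IHp IHq.
- rewrite /= maximal_forcing_not // forcing_and lfilter_meetP.
  by rewrite !maximal_forcing_not // IHp IHq not_andP !notK.
- by rewrite /= maximal_forcing_imp // IHp IHq.
- rewrite [godel _]/= maximal_forcing_all //=; split=> [sp b mb|mp x].
    have mba := tconsP _ _ _ ma mb.
    by rewrite -(IHp _ mba) -(gtuple_tcons ma mb).
  (* Every element of the quotient is the class of some [b] whose extent is in [m]. *)
  rewrite -(gclass_grepr x) (gtuple_tcons _ _ (tconsP _ _ _ ma (grepr_ext x))).
  by apply/IHp; apply: mp; exact: grepr_ext.
- rewrite maximal_godel_ex //=; split=> [[x]|mp].
    rewrite -(gclass_grepr x) (gtuple_tcons _ _ (tconsP _ _ _ ma (grepr_ext x))).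
    move/IHp; apply: lfilter_up; rewrite forcing_ex; exact: (vee_ub (fun b => _)).
  (* Genericity gives [b]; strictness of forcing shows that its extent is in [m], so that it has a
     class in the quotient. *)
  have [b mpb] := m_ex ma mp.
  have mba : m (tuple_ext (tcons b a)) by apply: lfilter_up (forcing_ext _ _) mpb.
  have mb : m (vext b) by move: mba; rewrite tuple_ext_tcons => /lfilter_meetP[].
  by exists (gclass mb); rewrite (gtuple_tcons _ _ mba); apply/IHp.
Qed.

End Los.

Theorem mainTheorem1 (d : Order.disp_t) (O : frameType d) (L : language)
    (M : vstructure O L) (h : representing_maps M) :
  let cond_i :=
    forall (n : nat) (p : formula L n.+1) (a : 'I_n -> M),
    exists bs : seq M,
      \join_(b <- bs) forcing (godel p) (tcons b a)
        <= forcing (FEx (godel p)) a /\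
      forcing (FEx (godel p)) a
        <= hneg (hneg (\join_(b <- bs) forcing (godel p) (tcons b a))) in
  let cond_ii :=
    forall m : lfilter O, maximal_lfilter m -> generic M m in
  let cond_iii :=
    forall m : lfilter O, maximal_lfilter m ->
    forall (n : nat) (p : formula L n) (a : 'I_n -> M) (ma : m (tuple_ext a)),
      sat p (gtuple h ma) <-> m (forcing (godel p) a) in
  (cond_i <-> cond_ii) /\ (cond_ii <-> cond_iii).
Proof.
move=> cond_i cond_ii cond_iii; split; split.
- move=> ci m mm; split=> [n p a|n p a ma mE]; first exact: maximal_godel_em.
  have [bs [_ /lfilter_up/(_ mE) mbs]] := ci n p a.
  apply: (maximal_bigjoin (s := bs) mm).
  (* A maximal filter containing a double negation contains the element itself; primeness then
     selects one member of the finite join. *)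
  move/(maximal_hneg _ mm): mbs => mbs.
  by apply: contrapT => /(maximal_hneg _ mm).
- move=> cii n p a.
  have [|bs Ebs] := @maximal_dense_subcover _ _ M (forcing (FEx (godel p)) a)
      (fun b => forcing (godel p) (tcons b a)).
    (* The extent of [a] is not assumed to lie in [m]: it does because it bounds the existential,
       which does. *)
    move=> m mm mE; apply: (cii m mm).2 (mE).
    exact: lfilter_up (forcing_ext _ _) mE.
  exists bs; split=> //.
  apply: (big_ind (fun x => x <= forcing (FEx (godel p)) a)) => [|x y xE yE|b _].
  + exact: le0x.
  + by rewrite leUx xE.
  + by rewrite forcing_ex; exact: (vee_ub (fun b => _)).
- by move=> cii m mm n p a ma; apply: los => //; exact: (cii m mm).2.
- move=> ciii m mm; split=> [n p a|n p a ma]; first exact: maximal_godel_em.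
  (* The theorem of Los for [FEx p] yields an element [x] of the quotient; applied again to [p], it
     makes the representative of [x] the required witness. *)
  rewrite -maximal_godel_ex // -(ciii m mm _ _ _ ma) => -[x].
  have mxa : m (tuple_ext (tcons (grepr x) a)).
    by rewrite tuple_ext_tcons; apply: lfilter_meet (grepr_ext x) ma.
  rewrite -(gclass_grepr x) (gtuple_tcons _ _ _ mxa).
  by move/(ciii m mm); exists (grepr x).
Qed.
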